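(* Let $\beta>0$, $\gamma\ge0$ and $0<\eta\le 1/(2\beta)$. Let $\boldsymbol\lambda_0=0$ and let $(\boldsymbol\lambda_t)_{t\ge0}$ in $\mathbb{R}^m$ satisfy $$\boldsymbol\lambda_{t+1}\in\underset{\boldsymbol\lambda\in\mathbb{R}^m}{\mathrm{argmin}}\Big\{f_\beta(\boldsymbol\lambda_t)+g_t\cdot(\boldsymbol\lambda-\boldsymbol\lambda_t)+\frac{1}{2\eta}\|\boldsymbol\lambda-\boldsymbol\lambda_t\|^2\Big\},\qquad t=0,1,2,\dots,$$ where the gradient estimates $g_t\in\mathbb{R}^m$ satisfy $\|g_t-\nabla f_\beta(\boldsymbol\lambda_t)\|_*\le\gamma$ for all $t$. Let $\boldsymbol\lambda_\star$ be a minimizer of $f_\beta$, assume that $$D:=\sup_{t=0,1,2,\dots}\|\boldsymbol\lambda_t-\boldsymbol\lambda_\star\|^2<+\infty,$$ and assume that $\gamma\le\sqrt{3\beta^2D/2}$. Then for any $t\ge1$, $$f_\beta(\boldsymbol\lambda_t)-f_\beta(\boldsymbol\lambda_\star)\le\bigg(1-\frac{2\gamma}{\sqrt{2(\eta^{-1}-\beta)(2\eta^{-1}-\beta)D}}\bigg)^{t}\big[f_\beta(\boldsymbol\lambda_0)-f_\beta(\boldsymbol\lambda_\star)\big]+\frac{\gamma\sqrt{2(2\eta^{-1}-\beta)D}}{\sqrt{\eta^{-1}-\beta}}.$$ Specifically, if $\eta=1/(2\beta)$, then $$f_\beta(\boldsymbol\lambda_t)-f_\beta(\boldsymbol\lambda_\star)\le\bigg(1-\frac{2\gamma}{\sqrt{6\beta^2D}}\bigg)^{t}\big[f_\beta(\boldsymbol\lambda_0)-f_\beta(\boldsymbol\lambda_\star)\big]+\gamma\sqrt{6D}.$$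 (If $D=0$, in which case $\gamma=0$, the quotients with $\sqrt{D}$ in the denominator are read as $0$.)
   Context: Let $C,A_1,\dots,A_m\in\mathbb{R}^{n\times n}$ be symmetric and $\mathbf{b}\in\mathbb{R}^m$. For $\boldsymbol\lambda\in\mathbb{R}^m$ write $\boldsymbol\lambda\cdot\mathbf{A}=\sum_{i=1}^m\lambda_iA_i$. It is assumed that the semidefinite program of minimizing $\mathrm{Tr}[CX]$ over symmetric $X\in\mathbb{R}^{n\times n}$ subject to $\mathrm{Tr}[A_iX]=b_i$ ($i=1,\dots,m$), $\mathrm{Tr}[X]=1$, $X\succeq0$, is feasible. For $\beta>0$ define the (negated) dual objective of its entropic regularization $$f_\beta(\boldsymbol\lambda)=-\mathbf{b}\cdot\boldsymbol\lambda+\beta^{-1}\log\mathrm{Tr}\big[e^{-\beta(C-\boldsymbol\lambda\cdot\mathbf{A})}\big],\qquad \boldsymbol\lambda\in\mathbb{R}^m .$$ $\|\cdot\|$ is a norm on $\mathbb{R}^m$ such that $\|\boldsymbol\lambda\cdot\mathbf{A}\|_2\le\|\boldsymbol\lambda\|$ for all $\boldsymbol\lambda\in\mathbb{R}^m$, where $\|\cdot\|_2$ is the spectral norm; $\|\cdot\|_*$ is its dual norm. *)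

(* Defs.v *)
(* Points of R^m are rows; vectors of R^n acted on by n x n matrices are columns. *)
From HB Require Import structures.
From mathcomp Require Import all_boot all_order all_algebra.
From mathcomp Require Import all_classical all_reals all_analysis.

Set Implicit Arguments.
Unset Strict Implicit.
Unset Printing Implicit Defensive.

Import Order.TTheory GRing.Theory Num.Theory.
Import numFieldNormedType.Exports.

Local Open Scope classical_set_scope.
Local Open Scope ring_scope.

Section defs.
Context {R : realType}.

Definition argmin {T : Type} (F : T -> R) : set T :=
  [set x | forall y, F x <= F y].

Definition dot {m} (u v : 'rV[R]_m) : R := \sum_(i < m) u 0 i * v 0 i.

(* Nonnegativity is not listed since it follows from the first two fields. *)
Record is_norm {m} (N : 'rV[R]_m -> R) : Prop := IsNorm {
  is_norm_triangle : forall x y, N (x + y) <= N x + N y ;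
  is_norm_scale : forall a x, N (a *: x) = `|a| * N x ;
  is_norm_eq0 : forall x, N x = 0 -> x = 0 }.

(* For a norm N on R^m the supremum is that of a nonempty bounded set. *)
Definition dual_norm {m} (N : 'rV[R]_m -> R) (g : 'rV[R]_m) : R :=
  sup [set dot g x | x in [set x | N x <= 1]].

Definition grad {m} (f : 'rV[R]_m -> R) (x : 'rV[R]_m) : 'rV[R]_m :=
  \row_(i < m) 'D_(delta_mx 0 i) f x.

Definition l2norm {n} (x : 'cV[R]_n) : R :=
  Num.sqrt (\sum_(i < n) x i 0 ^+ 2).

(* The library norm `|A| on matrices is the entrywise maximum, hence this one
   for the operator norm induced by the Euclidean norm. *)
Definition spectral_norm {n} (A : 'M[R]_n) : R :=
  sup [set l2norm (A *m x) | x in [set x | l2norm x <= 1]].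

Definition psd {n} (X : 'M[R]_n) : Prop :=
  X \is symmetricmx /\ forall x : 'cV[R]_n, 0 <= (x^T *m X *m x) 0 0.

Definition expmx {n} (A : 'M[R]_n) : 'M[R]_n :=
  limn (series (fun k => k`!%:R^-1 *: A ^+ k)).

Definition lincomb {n m} (lam : 'rV[R]_m) (A : 'I_m -> 'M[R]_n) : 'M[R]_n :=
  \sum_(i < m) lam 0 i *: A i.

Definition sdp_feasible {n m} (A : 'I_m -> 'M[R]_n) (b : 'rV[R]_m) :
    set 'M[R]_n :=
  [set X | [/\ forall i, \tr (A i *m X) = b 0 i, \tr X = 1 & psd X]].

Definition fdual {n m} (C : 'M[R]_n) (A : 'I_m -> 'M[R]_n) (b : 'rV[R]_m)
    (beta : R) (lam : 'rV[R]_m) : R :=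
  - dot b lam + beta^-1 * ln (\tr (expmx (- beta *: (C - lincomb lam A)))).

End defs.

(* Main.v *)
(** The functional [M |-> ln tr exp M] on symmetric matrices is convex and
    1-smooth for the spectral norm, by a purely spectral argument.  If
    [B] has eigenpairs [(b_i, e_i)] and [A] has eigenpairs [(a_j, f_j)], then
    [w_ij = <e_i, f_j>^2] is doubly stochastic, [<e_i, (B - A) f_j>] equals
    [(b_i - a_j) <e_i, f_j>], and both inequalities become scalar inequalities
    for the Gibbs weights, weighted by [w_ij] and summed.  Convexity is
    [ln x <= x - 1]; smoothness is the pointwise form of Pinsker's inequality,
    [p ln (p / q) - p + q >= 3/2 (p - q)^2 / (p + 2 q)], followed by AM-GM.
    Such two-sided quadratic bounds on increments also identify the gradient.

    Comparing the iterate with the point [l_t + a (l_* - l_t)] then gives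
    [delta_(t+1) <= (1 - a) delta_t + a^2 L D / 2 + gamma^2 / c], where
    [c = 1/eta - beta] and [L = 2/eta - beta]; the choice
    [a = 2 gamma / sqrt (2 c L D)] makes the last two terms equal. *)
Require Import Defs.
From HB Require Import structures.
From mathcomp Require Import all_boot all_order all_algebra.
From mathcomp Require Import all_classical all_reals all_analysis.
From mathcomp Require Import ring lra.

Set Implicit Arguments.
Unset Strict Implicit.
Unset Printing Implicit Defensive.

Import Order.TTheory GRing.Theory Num.Theory.
Import numFieldNormedType.Exports.

Local Open Scope classical_set_scope.
Local Open Scope ring_scope.

(** * Dot product of rows and compact slices of the unit sphere *)

Section sphere.
Context {R : realType}.

Lemma continuous_sumr (T : topologicalType) (I : Type) (r : seq I)
    (F : I -> T -> R) :
  (forall i, continuous (F i)) -> continuous (fun x => \sum_(i <- r) F i x).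
Proof.
by move=> cF; apply: continuous_big => // x; exact: add_continuous.
Qed.

Lemma dotvv_ge0 m (x : 'rV[R]_m) : 0 <= dot x x.
Proof. by apply: sumr_ge0 => i _; rewrite -expr2 sqr_ge0. Qed.

Lemma dotvv_ge_coord m (x : 'rV[R]_m) i : x 0 i ^+ 2 <= dot x x.
Proof.
rewrite /dot (bigD1 i)//= -expr2 lerDl.
by apply: sumr_ge0 => j _; rewrite -expr2 sqr_ge0.
Qed.

Lemma dotvv_eq0 m (x : 'rV[R]_m) : dot x x = 0 -> x = 0.
Proof.
move=> x0; apply/rowP => i; rewrite mxE; apply/eqP.
by rewrite -sqrf_eq0 eq_le sqr_ge0 andbT -x0 dotvv_ge_coord.
Qed.

Lemma dotmxE m (x y : 'rV[R]_m) : x *m y^T = (dot x y)%:M.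
Proof.
apply/rowP => i; rewrite (ord1 i) !mxE mulr1n.
by apply: eq_bigr => j _; rewrite mxE.
Qed.

Lemma dotDl m (x y z : 'rV[R]_m) : dot (x + y) z = dot x z + dot y z.
Proof. by rewrite -big_split/=; apply: eq_bigr => i _; rewrite mxE mulrDl. Qed.

Lemma dotZl m a (x z : 'rV[R]_m) : dot (a *: x) z = a * dot x z.
Proof. by rewrite mulr_sumr; apply: eq_bigr => i _; rewrite mxE mulrA. Qed.

Lemma dotC m (x y : 'rV[R]_m) : dot x y = dot y x.
Proof. by apply: eq_bigr => i _; rewrite mulrC. Qed.

Lemma dotDr m (x y z : 'rV[R]_m) : dot z (x + y) = dot z x + dot z y.
Proof. by rewrite dotC dotDl !(dotC z). Qed.

Lemma dotZr m a (x z : 'rV[R]_m) : dot z (a *: x) = a * dot z x.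
Proof. by rewrite dotC dotZl dotC. Qed.

Lemma dotNr m (x y : 'rV[R]_m) : dot x (- y) = - dot x y.
Proof. by rewrite -sumrN; apply: eq_bigr => i _; rewrite mxE mulrN. Qed.

(** With [W] the transpose of eigenrows already found, this is the domain of a Rayleigh quotient;
    with [k = 0] it is the whole sphere, as used for norm equivalence. *)
Lemma compact_sphere_kernel m k (W : 'M[R]_(m, k)) :
  compact [set x : 'rV[R]_m | dot x x = 1 /\ x *m W = 0].
Proof.
apply: bounded_closed_compact.
- exists 1; split=> // M M1 x [x1 _] /=; rewrite /Num.norm/= mx_normrE.
  apply/bigmax_leP; split=> [|[i j] _ /=]; first by rewrite (le_trans _ (ltW M1)).
  apply: le_trans (ltW M1); rewrite (ord1 i).
  by rewrite -(@ler_pXn2r _ 2) ?nnegrE// expr1n real_normK ?num_real// -x1 dotvv_ge_coord.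
- apply: closedI.
    apply: (@preimage_closed _ _ (fun x : 'rV[R]_m => dot x x) [set 1]).
      move=> x _; apply: continuous_sumr => i {}x.
      by apply: continuousM; exact: (@coord_continuous R 1 m 0 i).
    exact: (@closed_eq R 1).
  rewrite [X in closed X](_ : _ = \bigcap_(j in [set: 'I_k])
    (fun x : 'rV[R]_m => \sum_i x 0 i * W i j) @^-1` [set 0]).
    apply: closed_bigI => j _; apply: preimage_closed; last exact: (@closed_eq R 0).
    move=> x _; apply: continuous_sumr => i {}x.
    by apply: continuousM; [exact: (@coord_continuous R 1 m 0 i)|exact: cst_continuous].
  apply/seteqP; split=> x /=.
    by move=> xW j _ /=; move/rowP: xW => /(_ j); rewrite !mxE.
  by move=> xW; apply/rowP => j; rewrite !mxE; exact: xW.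
Qed.

Lemma sphere_kernel_nonempty m k (W : 'M[R]_(m, k)) : (k < m)%N ->
  [set x : 'rV[R]_m | dot x x = 1 /\ x *m W = 0] !=set0.
Proof.
move=> km; have /rowV0Pn[v /sub_kermxP vW v0] : kermx W != 0.
  rewrite -mxrank_eq0 mxrank_ker -lt0n subn_gt0.
  by apply: leq_ltn_trans km; rewrite rank_leq_col.
exists ((Num.sqrt (dot v v))^-1 *: v); split; last by rewrite -scalemxAl vW scaler0.
have vv : 0 < dot v v.
  rewrite lt_neqAle dotvv_ge0 andbT eq_sym; apply/eqP => /dotvv_eq0 vE.
  by rewrite vE eqxx in v0.
rewrite dotZl dotZr mulrA -expr2 exprVn sqr_sqrtr ?ltW//.
by rewrite mulVf// gt_eqF.
Qed.

End sphere.

(** * Spectral theorem for real symmetric matrices *)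

Section spectral.
Context {R : realType}.

(** The vector maximizes the Rayleigh quotient on the unit sphere of the orthogonal complement of
    the rows of [V]. This complement is stable under [A], so the residual [mu *: v - v *m A] is an
    admissible direction of variation. *)
Lemma max_on_sphere_eigenvector m k (A : 'M[R]_m) (V : 'M[R]_(k, m)) (d : 'rV[R]_k) :
    A^T = A -> (k < m)%N -> V *m A = diag_mx d *m V ->
  exists (v : 'rV[R]_m) (mu : R),
    [/\ dot v v = 1, v *m V^T = 0 & v *m A = mu *: v].
Proof.
move=> symA km VA; pose S := [set x : 'rV[R]_m | dot x x = 1 /\ x *m V^T = 0].
have [] := @EVT_max_rV R m (fun x => dot (x *m A) x) S.
- exact: sphere_kernel_nonempty.
- exact: compact_sphere_kernel.
- apply: continuous_subspaceT; apply: continuous_sumr => i x.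
  apply: continuousM; last exact: (@coord_continuous R 1 m 0 i).
  suff : continuous (fun x : 'rV[R]_m => (x *m A) 0 i) by exact.
  rewrite (_ : (fun x : 'rV[R]_m => _) = fun x => \sum_j x 0 j * A j i); last first.
    by apply/funext => z; rewrite mxE.
  apply: continuous_sumr => j z.
  by apply: continuousM; [exact: (@coord_continuous R 1 m 0 j)|exact: cst_continuous].
move=> v /set_mem[vv vV] vmax; pose mu := dot (v *m A) v.
exists v, mu; split => //.
(* Homogeneous form of the maximality of [v]: nonnegative on the whole complement. *)
pose q x := mu * dot x x - dot (x *m A) x.
have q_ge0 x : x *m V^T = 0 -> 0 <= q x.
  move=> xV; have [/dotvv_eq0 ->|x0] := eqVneq (dot x x) 0.
    by rewrite /q mul0mx /dot !big1 ?mulr0 ?subrr// => i _; rewrite mxE mul0r.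
  have xx : 0 < dot x x by rewrite lt_neqAle eq_sym x0 dotvv_ge0.
  pose s := (Num.sqrt (dot x x))^-1.
  have s2 : s * s = (dot x x)^-1 by rewrite -expr2 exprVn sqr_sqrtr ?ltW.
  have : dot ((s *: x) *m A) (s *: x) <= mu.
    apply: vmax; apply/mem_set; split; last by rewrite -scalemxAl xV scaler0.
    by rewrite dotZl dotZr mulrA s2 mulVf.
  rewrite -scalemxAl dotZl dotZr mulrA s2 mulrC ler_pdivrMr//.
  by rewrite /q subr_ge0.
pose y := mu *: v - v *m A.
have yV : y *m V^T = 0.
  rewrite mulmxBl -scalemxAl vV scaler0 sub0r -mulmxA -symA -trmx_mul VA.
  by rewrite trmx_mul mulmxA vV mul0mx oppr0.
have dotA x z : dot (x *m A) z = dot x (z *m A).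
  have /(congr1 (fun M : 'M[R]_1 => M 0 0)) : (x *m A) *m z^T = x *m (z *m A)^T.
    by rewrite trmx_mul symA mulmxA.
  by rewrite !dotmxE !mxE !mulr1n.
(* q vanishes at v and is nonnegative along the line v + t y, which forces the
   first-order term 2 t |y|^2 to vanish. *)
have qE z t : q (v + t *: z) =
    2 * t * (mu * dot v z - dot (v *m A) z) + t ^+ 2 * q z.
  rewrite /q mulmxDl -scalemxAl !(dotDl, dotDr, dotZl, dotZr).
  rewrite (dotC z v) (dotA z v) (dotC z (v *m A)) -/mu vv; ring.
have yE : mu * dot v y - dot (v *m A) y = dot y y.
  by rewrite -dotZl -[X in _ - X]mul1r -mulNr -dotZl -dotDl scaleN1r.
suff /dotvv_eq0/eqP : dot y y = 0 by rewrite subr_eq0 => /eqP.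
apply/eqP; rewrite eq_le dotvv_ge0 andbT leNgt; apply/negP => yy.
have line t : 0 <= 2 * t * dot y y + t ^+ 2 * q y.
  by rewrite -yE -qE q_ge0// mulmxDl -scalemxAl yV scaler0 vV addr0.
have qy := q_ge0 _ yV; have q1 : 0 < q y + 1 by rewrite ltr_wpDl.
(* A small negative [t] makes the linear term win; the [+ 1] covers the case [q y = 0]. *)
have := line (- (dot y y / (q y + 1))).
suff : 2 * - (dot y y / (q y + 1)) * dot y y + (- (dot y y / (q y + 1))) ^+ 2 * q y < 0.
  by rewrite ltNge => /negP.
rewrite (_ : _ + _ = - (dot y y ^+ 2 * (q y + 2) / (q y + 1) ^+ 2)).
  by rewrite oppr_lt0 divr_gt0 ?exprn_gt0// mulr_gt0 ?exprn_gt0// ltr_wpDl.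
by field; rewrite gt_eqF.
Qed.

(** Partial eigenbases are allowed so that induction on [k] can append one unit eigenvector,
    orthogonal to the previous rows, at a time. *)
Lemma orthonormal_eigenrows m (A : 'M[R]_m) k : A^T = A -> (k <= m)%N ->
  exists (V : 'M[R]_(k, m)) (d : 'rV[R]_k),
    V *m V^T = 1%:M /\ V *m A = diag_mx d *m V.
Proof.
move=> symA; elim: k => [_|k IH km].
  by exists 0, 0; split; apply/matrixP => -[].
have [V [d [VV VA]]] := IH (ltnW km).
have [v [mu [vv vV vA]]] := max_on_sphere_eigenvector symA km VA.
rewrite -addn1; exists (col_mx V v), (row_mx d (const_mx mu)); split.
  rewrite tr_col_mx mul_col_row VV vV dotmxE vv -[V *m _]trmxK trmx_mul trmxK vV.
  by rewrite trmx0 scalar_mx_block.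
by rewrite diag_mx_row mul_col_mx VA vA mul_block_col !mul0mx addr0 add0r
  diag_const_mx mul_scalar_mx.
Qed.

Theorem symmetric_orthodiagonalizable m (A : 'M[R]_m) : A^T = A ->
  exists (P : 'M[R]_m) (d : 'rV[R]_m), P *m P^T = 1%:M /\ A = P^T *m diag_mx d *m P.
Proof.
move=> symA; have [P [d [PP PA]]] := orthonormal_eigenrows symA (leqnn m).
by exists P, d; split=> //; rewrite -mulmxA -PA mulmxA (mulmx1C PP) mul1mx.
Qed.

End spectral.

(** * Matrix exponential in an eigenbasis *)

Section expmx.
Context {R : realType}.

Lemma cvg_mx m n (u : nat -> 'M[R]_(m, n)) (L : 'M[R]_(m, n)) :
  (forall i j, u k i j @[k --> \oo] --> L i j) -> u @ \oo --> L.
Proof.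
move=> uL; apply/cvg_ballP => e e0.
have : \forall k \near \oo, forall ij : 'I_m * 'I_n,
    ball (L ij.1 ij.2) e (u k ij.1 ij.2).
  by apply: filter_forall => -[i j]; move/cvg_ballP: (uL i j); exact.
by apply: filterS => k uk; split=> // i j; exact: (uk (i, j)).
Qed.

Lemma orthodiag_exp n (P : 'M[R]_n) (d : 'rV[R]_n) k : P *m P^T = 1%:M ->
  (P^T *m diag_mx d *m P) ^+ k = P^T *m diag_mx (map_mx (fun x => x ^+ k) d) *m P.
Proof.
move=> PP; elim: k => [|k IH].
  rewrite expr0 (_ : map_mx _ _ = const_mx 1).
    by rewrite diag_const_mx mulmx1 (mulmx1C PP).
  by apply/rowP => i; rewrite !mxE expr0.
rewrite exprS IH -[LHS]/(_ *m _) !mulmxA -(mulmxA _ P) PP mulmx1.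
rewrite -(mulmxA P^T) mulmx_diag; congr (_ *m diag_mx _ *m _).
by apply/rowP => i; rewrite !mxE exprS.
Qed.

Lemma orthodiagE n (P : 'M[R]_n) (d : 'rV[R]_n) i j :
  (P^T *m diag_mx d *m P) i j = \sum_l P l i * d 0 l * P l j.
Proof.
rewrite mxE; apply: eq_bigr => l _.
by rewrite mul_mx_diag !mxE.
Qed.

(** Powers act on the eigenvalues alone, so each entry of a partial sum is a finite combination of
    scalar exponential series. *)
Lemma expmx_orthodiag n (P : 'M[R]_n) (d : 'rV[R]_n) : P *m P^T = 1%:M ->
  expmx (P^T *m diag_mx d *m P) = P^T *m diag_mx (map_mx expR d) *m P.
Proof.
move=> PP; apply: cvg_lim; first exact: norm_hausdorff.
apply: cvg_mx => i j; rewrite orthodiagE.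
rewrite (_ : (fun k => _) =
    (fun k => \sum_l P l i * series (exp_coeff (d 0 l)) k * P l j)); last first.
  apply/funext => N; rewrite /series/= summxE.
  under [RHS]eq_bigr do rewrite mulr_sumr mulr_suml.
  rewrite [RHS]exchange_big/=; apply: eq_bigr => k _.
  rewrite mxE orthodiag_exp// orthodiagE mulr_sumr; apply: eq_bigr => l _.
  by rewrite !mxE /exp_coeff/=; ring.
apply: cvg_big => [x|l _]; first exact: add_continuous.
rewrite mxE; apply: cvgM; last exact: cvg_cst.
by apply: cvgM; [exact: cvg_cst|exact: is_cvg_series_exp_coeff].
Qed.

Lemma mxtrace_orthodiag n (P : 'M[R]_n) (d : 'rV[R]_n) (M : 'M[R]_n) :
  \tr (P^T *m diag_mx d *m P *m M) = \sum_j d 0 j * (P *m M *m P^T) j j.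
Proof.
rewrite -!mulmxA mxtrace_mulC -!mulmxA; apply: eq_bigr => j _.
by rewrite mul_diag_mx mxE !mulmxA.
Qed.

End expmx.

(** * Scalar inequalities for the logarithm and relative entropy *)

Section scalar.
Context {R : realType}.
Implicit Types p q r x : R.

Let G x : R := (x - 1) * (5 * x + 1) / (2 * x * (x + 2)).

(** The cube gives the derivative the sign of [x - 1]. *)
Let is_derive_lnBG x : 0 < x ->
  is_derive x 1 (fun r => ln r - G r) ((x - 1) ^+ 3 / (x ^+ 2 * (x + 2) ^+ 2)).
Proof.
move=> x0; have d0 : 2 * x * (x + 2) != 0 by rewrite gt_eqF//; nra.
have x0' := is_derive1_ln x0.
have dV : is_derive x 1 (fun r => (2 * r * (r + 2))^-1)
    (- (2 * x * (x + 2)) ^- 2 * (4 * x + 4)).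
  apply: is_deriveV => //; apply: is_derive_eq.
  by rewrite /GRing.scale /=; ring.
apply: is_derive_eq.
rewrite /GRing.scale /=; field; rewrite ?gt_eqF//; nra.
Qed.

(* The bound is relative_entropy_ge below at r = p / q, solved for ln r. *)
Lemma ln_ge_rational r : 0 < r -> (r - 1) * (5 * r + 1) / (2 * r * (r + 2)) <= ln r.
Proof.
move=> r0; rewrite -subr_ge0 -/(G r).
pose F x := ln x - G x; rewrite -/(F r).
have F1 : F 1 = 0 by rewrite /F /G ln1 subrr !mul0r subrr.
have cF a b : 0 < a -> {within `[a, b], continuous F}.
  move=> a0; apply: continuous_in_subspaceT => x; rewrite inE/= in_itv/= => /andP[ax _].
  have xgt0 : 0 < x by apply: lt_le_trans ax.
  have [dx _] := is_derive_lnBG xgt0.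
  exact/differentiable_continuous/derivable1_diffP.
have dF a b : 0 < a -> forall x, x \in `]a, b[ ->
    is_derive x 1 F ((x - 1) ^+ 3 / (x ^+ 2 * (x + 2) ^+ 2)).
  move=> a0 x; rewrite in_itv/= => /andP[ax _]; apply: is_derive_lnBG.
  exact: lt_trans ax.
have dpos x : 0 < x -> 0 < x ^+ 2 * (x + 2) ^+ 2.
  by move=> x0; rewrite mulr_gt0// exprn_gt0// addr_gt0.
(* As [F] vanishes at 1, [F r] is the derivative at some intermediate [c] times [r - 1], and both
   factors have the same sign. *)
have [r1|r1|->] := ltgtP r 1; last by rewrite F1.
- have [c] := MVT r1 (dF _ _ r0) (cF _ _ r0).
  rewrite in_itv/= => /andP[rc c1].
  rewrite F1 sub0r => E; rewrite -[F r]opprK E oppr_ge0.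
  have c0 : 0 < c by apply: lt_trans rc.
  rewrite mulr_le0_ge0 ?subr_ge0 ?(ltW r1)//.
  rewrite mulr_le0_ge0 ?invr_ge0 ?(ltW (dpos _ c0))//.
  by rewrite exprn_odd_le0// subr_le0 ltW.
- have [c] := MVT r1 (dF _ _ ltr01) (cF _ _ ltr01).
  rewrite in_itv/= => /andP[rc c1].
  rewrite F1 subr0 => ->.
  have c0 : 0 < c by apply: lt_trans rc.
  rewrite mulr_ge0 ?subr_ge0 ?(ltW r1)//.
  rewrite mulr_ge0 ?invr_ge0 ?(ltW (dpos _ c0))//.
  by rewrite exprn_ge0// subr_ge0 ltW.
Qed.

Lemma relative_entropy_ge p q : 0 < p -> 0 < q ->
  3 / 2 * (p - q) ^+ 2 / (p + 2 * q) <= p * (ln p - ln q) - p + q.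
Proof.
move=> p0 q0.
have := ln_ge_rational (divr_gt0 p0 q0).
rewrite ln_div ?posrE// => /(ler_wpM2l (ltW p0)).
rewrite -lerBlDr lerBrDr; apply: le_trans.
rewrite le_eqVlt; apply/orP; left; apply/eqP; field.
by rewrite !gt_eqF//; nra.
Qed.

(** In the application [h] is a difference of eigenvalues and [D] the increment of the log-partition
    function. The left side is [(p - q) * h] minus the relative entropy; AM-GM trades the product
    for [h ^+ 2]. *)
Lemma relative_entropy_amgm p q h D : 0 < p -> 0 < q -> ln p - ln q = h - D ->
  - (q * h) + p * D + p - q <= (p + 2 * q) * h ^+ 2 / 6.
Proof.
move=> p0 q0 pqE; have := relative_entropy_ge p0 q0.
rewrite pqE => pq; have s0 : 0 < p + 2 * q by nra.
suff : (p - q) * h - 3 / 2 * (p - q) ^+ 2 / (p + 2 * q)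
    <= (p + 2 * q) * h ^+ 2 / 6 by nra.
rewrite -subr_ge0 (_ : _ - _ =
  (3 * (p - q) - (p + 2 * q) * h) ^+ 2 / (6 * (p + 2 * q))).
  by rewrite divr_ge0 ?sqr_ge0//; nra.
by field; rewrite gt_eqF.
Qed.

(** This is [q] times [ln x <= x - 1] at [x = p / q]. *)
Lemma ln_ratio_le p q h D : 0 < p -> 0 < q -> ln p - ln q = h - D ->
  q * h - q * D <= p - q.
Proof.
move=> p0 q0 pqE; rewrite -mulrBr -pqE.
have := le_ln1Dx (x := p / q - 1).
rewrite addrCA subrr addr0 ln_div ?posrE// ltrBrDl subrr divr_gt0// => /(_ isT).
move/(ler_wpM2l (ltW q0)) => /le_trans; apply.
by rewrite mulrBr mulr1 mulrCA divff ?mulr1// gt_eqF.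
Qed.

End scalar.

(** * Log-partition functions coupled by a doubly stochastic matrix *)

Section klein.
Context {R : realType}.

(** Second moments are bounded along rows and along columns because the quadratic remainder carries
    the weight [p i + 2 * q j]: rows serve [p], columns serve [q]. *)
Lemma log_partition_bounds n (w : 'I_n -> 'I_n -> R) (a b : 'I_n -> R) (c : R) :
    (0 < n)%N ->
    (forall i j, 0 <= w i j) ->
    (forall i, \sum_j w i j = 1) -> (forall j, \sum_i w i j = 1) ->
    (forall i, \sum_j w i j * (b i - a j) ^+ 2 <= c) ->
    (forall j, \sum_i w i j * (b i - a j) ^+ 2 <= c) ->
  let Za := \sum_j expR (a j) in
  let Zb := \sum_i expR (b i) in
  let d := \sum_j expR (a j) / Za * \sum_i w i j * (b i - a j) in
  d <= ln Zb - ln Za /\ ln Zb - ln Za <= d + c / 2.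
Proof.
move=> n0 w0 wr wc cr cc Za Zb d.
have Z0 (f : 'I_n -> R) : 0 < \sum_j expR (f j).
  rewrite (bigD1 (Ordinal n0))//= ltr_pwDl ?expR_gt0//.
  by apply: sumr_ge0 => i _; exact: expR_ge0.
have Za0 : 0 < Za by exact: Z0.
have Zb0 : 0 < Zb by exact: Z0.
pose q j := expR (a j) / Za; pose p i := expR (b i) / Zb.
have q0 j : 0 < q j by rewrite divr_gt0// expR_gt0.
have p0 i : 0 < p i by rewrite divr_gt0// expR_gt0.
have sq : \sum_j q j = 1 by rewrite -mulr_suml divff// gt_eqF.
have sp : \sum_i p i = 1 by rewrite -mulr_suml divff// gt_eqF.
have lE i j : ln (p i) - ln (q j) = (b i - a j) - (ln Zb - ln Za).
  by rewrite !ln_div ?posrE ?expR_gt0// !expRK; ring.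
set D := ln Zb - ln Za in lE *.
have swq (x : R) : \sum_i \sum_j w i j * (q j * x) = x.
  rewrite exchange_big/= -[RHS]mul1r -sq mulr_suml; apply: eq_bigr => j _.
  by rewrite -mulr_suml wc mul1r.
have swp (x : R) : \sum_i \sum_j w i j * (p i * x) = x.
  rewrite -[RHS]mul1r -sp mulr_suml; apply: eq_bigr => i _.
  by rewrite -mulr_suml wr mul1r.
have sd : \sum_i \sum_j w i j * (q j * (b i - a j)) = d.
  rewrite exchange_big/=; apply: eq_bigr => j _; rewrite mulr_sumr.
  by apply: eq_bigr => i _; rewrite mulrCA.
split.
- have : \sum_i \sum_j w i j * (q j * (b i - a j) - q j * D)
      <= \sum_i \sum_j w i j * (p i * 1 - q j * 1).
    apply: ler_sum => i _; apply: ler_sum => j _; rewrite !mulr1.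
    by apply: ler_wpM2l => //; exact: ln_ratio_le.
  have sumwB (F G : 'I_n -> 'I_n -> R) : \sum_i \sum_j w i j * (F i j - G i j) =
      \sum_i \sum_j w i j * F i j - \sum_i \sum_j w i j * G i j.
    rewrite -sumrB; apply: eq_bigr => i _; rewrite -sumrB.
    by apply: eq_bigr => j _; rewrite mulrBr.
  by rewrite !sumwB sd !swq swp subrr subr_le0.
- have : \sum_i \sum_j w i j * (- (q j * (b i - a j)) + p i * D + p i - q j)
      <= \sum_i \sum_j w i j * ((p i + 2 * q j) * (b i - a j) ^+ 2 / 6).
    apply: ler_sum => i _; apply: ler_sum => j _.
    by apply: ler_wpM2l => //; exact: relative_entropy_amgm.
  rewrite [X in X <= _](_ : _ = D - d); last first.
    transitivity (\sum_i \sum_j w i j * (p i * D)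
        - \sum_i \sum_j w i j * (q j * (b i - a j))
        + (\sum_i \sum_j w i j * (p i * 1) - \sum_i \sum_j w i j * (q j * 1))).
      rewrite -!sumrB -big_split/=; apply: eq_bigr => i _.
      by rewrite -!sumrB -big_split/=; apply: eq_bigr => j _; ring.
    by rewrite !swp sd swq subrr addr0.
  (* The weight [(p + 2 * q) / 6] splits as [p / 6 + q / 3]; with both averages at most [c], the
     total is [c / 6 + c / 3 = c / 2]. *)
  rewrite [X in _ <= X](_ : _ =
     (\sum_i p i * \sum_j w i j * (b i - a j) ^+ 2) / 6 +
     (\sum_j q j * \sum_i w i j * (b i - a j) ^+ 2) / 3); last first.
    under [X in _ + X / _]eq_bigr do rewrite mulr_sumr.
    rewrite [X in _ + X / _]exchange_big/= !mulr_suml -big_split/=.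
    apply: eq_bigr => i _; rewrite mulr_sumr !mulr_suml -big_split/=.
    by apply: eq_bigr => j _; field.
  have B (r f : 'I_n -> R) : (forall i, 0 < r i) -> \sum_i r i = 1 ->
      (forall i, f i <= c) -> \sum_i r i * f i <= c.
    move=> r0 r1 fc; rewrite -[leRHS]mul1r -r1 mulr_suml; apply: ler_sum => i _.
    by apply: ler_wpM2l => //; exact: ltW.
  have := B p _ p0 sp cr; have := B q _ q0 sq cc; lra.
Qed.

End klein.

(** * First- and second-order bounds for the log-trace-exponential *)

Section log_tr_exp.
Context {R : realType}.

Lemma l2norm_sqr n (x : 'cV[R]_n) : l2norm x ^+ 2 = \sum_i x i 0 ^+ 2.
Proof. by rewrite sqr_sqrtr// sumr_ge0// => i _; rewrite sqr_ge0. Qed.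

(** The set under the supremum must be shown bounded; absolute row sums give a crude bound. *)
Lemma l2norm_le_spectral_norm n (A : 'M[R]_n) (x : 'cV[R]_n) : l2norm x <= 1 ->
  l2norm (A *m x) <= spectral_norm A.
Proof.
move=> x1; apply: sup_ubound; last by exists x.
exists (Num.sqrt (\sum_k (\sum_j `|A k j|) ^+ 2)) => _ [y /= y1 <-].
apply: ler_wsqrtr; apply: ler_sum => k _.
rewrite -[leLHS]real_normK ?num_real//.
rewrite ler_pXn2r ?nnegrE ?sumr_ge0// mxE.
apply: le_trans (ler_norm_sum _ _ _) _; apply: ler_sum => j _.
rewrite normrM ler_piMr//.
have : \sum_i y i 0 ^+ 2 <= 1 by rewrite -l2norm_sqr expr_le1// sqrtr_ge0.
rewrite -(@ler_pXn2r _ 2) ?nnegrE// expr1n real_normK ?num_real//.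
apply: le_trans; rewrite (bigD1 j)//= lerDl.
by apply: sumr_ge0 => i _; exact: sqr_ge0.
Qed.

Lemma mulmx1_diag n (M N : 'M[R]_n) i : M *m N = 1%:M -> \sum_j M i j * N j i = 1.
Proof. by move/matrixP/(_ i i); rewrite !mxE eqxx. Qed.

(** Column [j] of [H *m P^T] is [H] applied to a unit vector, the transposed row [j] of [P]. *)
Lemma gram_orthonormal_le n (H P : 'M[R]_n) (c : R) j : P *m P^T = 1%:M ->
  spectral_norm H <= c -> \sum_i (H *m P^T) i j ^+ 2 <= c ^+ 2.
Proof.
move=> PP Hc; pose x := (row j P)^T.
have x1 : l2norm x = 1.
  rewrite -[RHS]sqrtr1; congr Num.sqrt.
  rewrite -(mulmx1_diag j PP).
  by apply: eq_bigr => i _; rewrite !mxE expr2.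
have := l2norm_le_spectral_norm H (eq_ind_r (fun z => z <= 1) (lexx 1) x1).
move=> /le_trans/(_ Hc) Hx.
rewrite (_ : \sum_i _ = l2norm (H *m x) ^+ 2).
  by rewrite ler_pXn2r ?nnegrE ?sqrtr_ge0// (le_trans _ Hx)// sqrtr_ge0.
rewrite l2norm_sqr; apply: eq_bigr => i _; congr (_ ^+ 2).
by rewrite !mxE; apply: eq_bigr => k _; rewrite !mxE.
Qed.

Lemma orthogonal_sum_sqr n (Q M : 'M[R]_n) j : Q *m Q^T = 1%:M ->
  \sum_i (Q *m M) i j ^+ 2 = \sum_i M i j ^+ 2.
Proof.
move=> QQ; have E (N : 'M[R]_n) : \sum_i N i j ^+ 2 = (N^T *m N) j j.
  by rewrite mxE; apply: eq_bigr => i _; rewrite mxE expr2.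
by rewrite !E trmx_mul mulmxA -(mulmxA M^T) (mulmx1C QQ) mulmx1.
Qed.

(** Here [d] is the mean of [B - A] in the Gibbs state of [A]. The matrices need not commute: the
    squared overlaps of their eigenbases couple the two spectra. *)
Theorem ln_tr_expmx_bounds n (A B : 'M[R]_n) (c : R) : (0 < n)%N ->
    A^T = A -> B^T = B -> spectral_norm (B - A) <= c ->
  let d := \tr (expmx A *m (B - A)) / \tr (expmx A) in
  d <= ln (\tr (expmx B)) - ln (\tr (expmx A)) /\
  ln (\tr (expmx B)) - ln (\tr (expmx A)) <= d + c ^+ 2 / 2.
Proof.
move=> n0 symA symB Hc.
have [P [a [PP AE]]] := symmetric_orthodiagonalizable symA.
have [Q [b [QQ BE]]] := symmetric_orthodiagonalizable symB.
pose U := Q *m P^T; pose w i j := U i j ^+ 2.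
have UU : U *m U^T = 1%:M.
  by rewrite trmx_mul trmxK mulmxA -(mulmxA Q) (mulmx1C PP) mulmx1.
have UU' : U^T *m U = 1%:M by exact: mulmx1C.
have wr i : \sum_j w i j = 1.
  rewrite -(mulmx1_diag i UU).
  by apply: eq_bigr => j _; rewrite [U^T _ _]mxE /w expr2.
have wc j : \sum_i w i j = 1.
  rewrite -(mulmx1_diag j UU').
  by apply: eq_bigr => i _; rewrite [U^T _ _]mxE /w expr2.
have HE : Q *m (B - A) *m P^T = diag_mx b *m U - U *m diag_mx a.
  rewrite mulmxBr mulmxBl {1}BE {1}AE !mulmxA QQ mul1mx.
  by rewrite -!mulmxA PP mulmx1 !mulmxA.
have hE i j : (Q *m (B - A) *m P^T) i j = (b 0 i - a 0 j) * U i j.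
  by rewrite HE mxE mul_diag_mx [X in _ + X]mxE mul_mx_diag !mxE; ring.
have symH : (B - A)^T = B - A by rewrite linearB/= symA symB.
have trE (O : 'M[R]_n) (d : 'rV[R]_n) : O *m O^T = 1%:M ->
    \tr (expmx (O^T *m diag_mx d *m O)) = \sum_j expR (d 0 j).
  move=> OO; rewrite expmx_orthodiag// -[X in \tr X]mulmx1 mxtrace_orthodiag.
  by apply: eq_bigr => j _; rewrite mulmx1 OO !mxE eqxx mulr1.
have trA : \tr (expmx A) = \sum_j expR (a 0 j) by rewrite AE trE.
have trB : \tr (expmx B) = \sum_j expR (b 0 j) by rewrite BE trE.
have trAH : \tr (expmx A *m (B - A)) =
    \sum_j expR (a 0 j) * \sum_i w i j * (b 0 i - a 0 j).
  rewrite {1}AE expmx_orthodiag// mxtrace_orthodiag; apply: eq_bigr => j _.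
  rewrite mxE; congr (_ * _).
  (* Inserting [Q^T *m Q = 1] reduces the diagonal entries in the eigenbasis of [A] to the mixed
     entries known from [hE]. *)
  rewrite (_ : P *m (B - A) *m P^T = U^T *m (Q *m (B - A) *m P^T)); last first.
    by rewrite trmx_mul trmxK !mulmxA -(mulmxA P Q^T) (mulmx1C QQ) mulmx1.
  by rewrite mxE; apply: eq_bigr => i _; rewrite hE mxE /w; ring.
have whE i j : w i j * (b 0 i - a 0 j) ^+ 2 = (Q *m (B - A) *m P^T) i j ^+ 2.
  by rewrite hE /w; ring.
move=> d.
have cr i : \sum_j w i j * (b 0 i - a 0 j) ^+ 2 <= c ^+ 2.
  under eq_bigr do rewrite whE.
  (* Transposition, using the symmetry of [B - A], turns the row sum into a column sum with [P] and
     [Q] exchanged. *)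
  rewrite (eq_bigr (fun j => (P *m ((B - A) *m Q^T)) j i ^+ 2)).
    by rewrite orthogonal_sum_sqr// gram_orthonormal_le.
  move=> j _; rewrite -[in LHS](trmxK (_ *m P^T)) [in LHS]mxE.
  by rewrite !trmx_mul trmxK symH.
have cc j : \sum_i w i j * (b 0 i - a 0 j) ^+ 2 <= c ^+ 2.
  under eq_bigr do rewrite whE -mulmxA.
  by rewrite orthogonal_sum_sqr// gram_orthonormal_le.
have := log_partition_bounds n0 (fun i j => sqr_ge0 (U i j)) wr wc cr cc.
cbv zeta; rewrite -trA -trB.
rewrite (_ : \sum_j _ * _ = d)//.
rewrite /d trAH mulr_suml; apply: eq_bigr => j _; ring.
Qed.

End log_tr_exp.

(** * General norms on rows, duality, and gradients from quadratic bounds *)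

Section norm.
Context {R : realType} {m : nat} (N : 'rV[R]_m -> R) (normN : is_norm N).

Lemma is_norm0 : N 0 = 0.
Proof. by rewrite -(scale0r 0) (is_norm_scale normN) normr0 mul0r. Qed.

Lemma is_normN x : N (- x) = N x.
Proof. by rewrite -scaleN1r (is_norm_scale normN) normrN1 mul1r. Qed.

Lemma is_norm_ge0 x : 0 <= N x.
Proof.
have := is_norm_triangle normN x (- x).
by rewrite subrr is_norm0 is_normN -mulr2n pmulrn_lge0.
Qed.

Lemma is_norm_gt0 x : x != 0 -> 0 < N x.
Proof.
move=> x0; rewrite lt_neqAle is_norm_ge0 andbT eq_sym.
by apply: contra_neq x0; exact: is_norm_eq0.
Qed.

Lemma is_norm_coord_le x : N x <= \sum_i `|x 0 i| * N (delta_mx 0 i).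
Proof.
rewrite {1}(row_sum_delta x).
elim/big_ind2: _ => [|a b c d ab cd|i _]; first by rewrite is_norm0.
  by apply: le_trans (is_norm_triangle normN _ _) _; exact: lerD.
by rewrite (is_norm_scale normN).
Qed.

Lemma is_norm_dist x y : `|N x - N y| <= N (x - y).
Proof.
have tri u v : N u - N v <= N (u - v).
  by rewrite lerBlDr -{1}(subrK v u); exact: is_norm_triangle.
by rewrite ler_norml tri andbT lerNl opprB -(is_normN (x - y)) opprB tri.
Qed.

Lemma is_norm_continuous : continuous N.
Proof.
move=> x; apply/(@cvgrPdist_le _ R^o _ (nbhs x) (nbhs_filter x)) => e e0.
pose S := \sum_i N (delta_mx 0 i) + 1.
have S0 : 0 < S.
  by rewrite ltr_wpDl// sumr_ge0// => i _; exact: is_norm_ge0.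
near=> y.
have [_ xy] : ball x (e / S) y by near: y; apply: nbhsx_ballx; rewrite divr_gt0.
apply: le_trans (is_norm_dist x y) _; apply: le_trans (is_norm_coord_le _) _.
apply: (@le_trans _ _ (\sum_i e / S * N (delta_mx 0 i))).
  apply: ler_sum => i _; apply: ler_wpM2r; first exact: is_norm_ge0.
  by rewrite !mxE; have /ltW := xy 0 i.
rewrite -mulr_sumr mulrAC ler_pdivrMr// ler_pM2l// /S lerDl//.
Unshelve. all: by end_near. Qed.

(** Half of the equivalence of norms: [N] attains a positive minimum on the Euclidean sphere, and
    homogeneity does the rest. *)
Lemma coord_le_is_norm : exists K, forall (x : 'rV[R]_m) i, `|x 0 i| <= K * N x.
Proof.
have [m0|m_gt0] := posnP m.
  by exists 0 => x i; have := ltn_ord i; rewrite [X in (_ < X)%N]m0.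
have [] := @EVT_min_rV R m N _ (@sphere_kernel_nonempty R m 0 0 m_gt0)
  (@compact_sphere_kernel R m 0 0).
  exact/continuous_subspaceT/is_norm_continuous.
move=> v /set_mem[vv _] vmin.
have Nv : 0 < N v.
  apply: is_norm_gt0; apply/eqP => v0; move: vv.
  rewrite v0 /dot big1 => [/esym/eqP|i _]; first by rewrite oner_eq0.
  by rewrite mxE mul0r.
exists (N v)^-1 => x i; rewrite mulrC ler_pdivlMr//.
have [/dotvv_eq0 ->|x0] := eqVneq (dot x x) 0.
  by rewrite mxE normr0 mul0r is_norm_ge0.
have xx : 0 < dot x x by rewrite lt_neqAle eq_sym x0 dotvv_ge0.
have s0 : 0 < Num.sqrt (dot x x) by rewrite sqrtr_gt0.
have : N v <= N ((Num.sqrt (dot x x))^-1 *: x).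
  apply: vmin; apply/mem_set; split; last by rewrite mulmx0.
  rewrite dotZl dotZr mulrA -expr2 exprVn sqr_sqrtr ?ltW//.
  by rewrite mulVf// gt_eqF.
rewrite (is_norm_scale normN) gtr0_norm ?invr_gt0// ler_pdivlMl//.
apply: le_trans; rewrite ler_pM2r//.
by rewrite -sqrtr_sqr ler_wsqrtr// dotvv_ge_coord.
Qed.

(** After normalizing [x] this is [sup_ubound]; [coord_le_is_norm] supplies the boundedness of the
    set. *)
Lemma dot_le_dual_norm (g x : 'rV[R]_m) : dot g x <= dual_norm N g * N x.
Proof.
have [->|x0] := eqVneq x 0.
  by rewrite is_norm0 mulr0 /dot big1// => i _; rewrite mxE mulr0.
have Nx := is_norm_gt0 x0.
rewrite -ler_pdivrMr// mulrC -dotZr; apply: sup_ubound; last first.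
  exists ((N x)^-1 *: x) => //=.
  by rewrite (is_norm_scale normN) gtr0_norm ?invr_gt0// mulVf// gt_eqF.
have [K KN] := coord_le_is_norm.
exists (\sum_i `|g 0 i| * `|K|) => _ [y /= y1 <-]; apply: ler_sum => i _.
apply: le_trans (ler_norm _) _; rewrite normrM; apply: ler_wpM2l => //.
apply: le_trans (KN _ _) _; apply: le_trans (ler_norm _) _.
by rewrite normrM ler_piMr// ger0_norm ?is_norm_ge0.
Qed.

(** Differentiability along the axes is derived: the difference quotient differs from the coordinate
    of [G] by at most a constant times [|h|]. *)
Lemma grad_of_quadratic_bounds (f : 'rV[R]_m -> R) (x G : 'rV[R]_m) (K : R) :
  (forall d, dot G d <= f (x + d) - f x /\
             f (x + d) - f x <= dot G d + K * N d ^+ 2) ->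
  grad f x = G.
Proof.
move=> fb; apply/rowP => i; rewrite mxE; apply: cvg_lim => //.
(* The sign of [K] is unknown, and the [+ 1] keeps [L] positive as a divisor. *)
set e := delta_mx 0 i; pose L := `|K| * N e ^+ 2 + 1.
have L0 : 0 < L by rewrite ltr_wpDl// mulr_ge0// sqr_ge0.
have Ge : dot G e = G 0 i.
  rewrite /dot (bigD1 i)//= mxE !eqxx mulr1 big1 ?addr0// => j /negPf ji.
  by rewrite mxE eqxx ji mulr0.
apply/cvgrPdist_le => eps eps0.
have hN : \forall h \near (0 : R)^', `|h| <= eps / L by apply: dnbhs0_le; rewrite divr_gt0.
have h0N : \forall h \near (0 : R)^', h != 0 by exact: nbhs_dnbhs_neq.
near=> h.
have h0 : h != 0 by near: h.
have /= := fb (h *: e); rewrite dotZr Ge (is_norm_scale normN) [x + _]addrC => -[fl fu].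
rewrite /= -[_^-1 *: _]/(_^-1 * _) -[G 0 i](mulKf h0) -mulrBr normrM normfV mulrC.
rewrite ler_pdivrMr ?normr_gt0// distrC.
rewrite (@le_trans _ _ (`|K| * (`|h| * N e) ^+ 2))//.
  rewrite [leLHS]ger0_norm ?subr_ge0// lerBlDl; apply: le_trans fu _.
  by rewrite lerD2l ler_wpM2r ?sqr_ge0// ler_norm.
rewrite exprMn mulrCA mulrC expr2 mulrA ler_pM2r ?normr_gt0//.
apply: (@le_trans _ _ (L * `|h|)); first by rewrite ler_wpM2r// /L lerDl.
rewrite mulrC -ler_pdivlMr//; near: h; exact: hN.
Unshelve. all: by end_near. Qed.

End norm.

(** * Convexity, smoothness and gradient of the dual objective *)

Section fdual.
Context {R : realType} {n m : nat} (C : 'M[R]_n) (A : 'I_m -> 'M[R]_n)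
  (b : 'rV[R]_m) (beta : R) (N : 'rV[R]_m -> R).
Hypotheses (symC : C \is symmetricmx) (symA : forall i, A i \is symmetricmx)
  (normN : is_norm N)
  (specN : forall lam : 'rV[R]_m, spectral_norm (lincomb lam A) <= N lam)
  (beta_gt0 : 0 < beta) (n_gt0 : (0 < n)%N).

Let trmx_sym (M : 'M[R]_n) : M \is symmetricmx -> M^T = M.
Proof. by move/is_hermitianmxP => {2}->; rewrite expr0 scale1r map_mx_id. Qed.

Lemma lincombD (l d : 'rV[R]_m) : lincomb (l + d) A = lincomb l A + lincomb d A.
Proof. by rewrite -big_split/=; apply: eq_bigr => i _; rewrite mxE scalerDl. Qed.

Lemma lincombZ a (l : 'rV[R]_m) : lincomb (a *: l) A = a *: lincomb l A.
Proof. by rewrite scaler_sumr; apply: eq_bigr => i _; rewrite mxE scalerA. Qed.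

Let H l := - beta *: (C - lincomb l A).

Let trH l : (H l)^T = H l.
Proof.
rewrite linearZ/= linearB/= trmx_sym// raddf_sum; congr (_ *: (_ - _)).
by apply: eq_bigr => i _ /=; rewrite linearZ/= trmx_sym.
Qed.

(** The constraint residuals in the Gibbs state; identified with the gradient in [grad_fdual], once
    the quadratic bounds are available. *)
Definition gibbs_gradient l : 'rV[R]_m :=
  \row_i (- b 0 i + \tr (expmx (H l) *m A i) / \tr (expmx (H l))).

(** Apply [ln_tr_expmx_bounds] with [c = beta * N d]; division by [beta] turns [c ^+ 2 / 2] into
    [beta / 2 * N d ^+ 2], and the term in [b] is exactly linear. *)
Lemma fdual_quadratic_bounds l d :
  dot (gibbs_gradient l) d
    <= fdual C A b beta (l + d) - fdual C A b beta l /\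
  fdual C A b beta (l + d) - fdual C A b beta l
    <= dot (gibbs_gradient l) d + beta / 2 * N d ^+ 2.
Proof.
have HB : H (l + d) - H l = beta *: lincomb d A.
  by rewrite /H lincombD; apply/matrixP => i j; rewrite !mxE; ring.
have Hc : spectral_norm (H (l + d) - H l) <= beta * N d.
  by rewrite HB -lincombZ (le_trans (specN _))// (is_norm_scale normN) gtr0_norm.
have [] := ln_tr_expmx_bounds n_gt0 (trH l) (trH (l + d)) Hc.
set Z := \tr _ / _; have -> : Z = beta * (dot (gibbs_gradient l) d + dot b d).
  rewrite -dotDl /Z HB -scalemxAr mxtraceZ -mulrA; congr (_ * _).
  rewrite mulmx_sumr raddf_sum mulr_suml; apply: eq_bigr => i _.
  by rewrite !mxE/= -scalemxAr mxtraceZ; ring.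
have -> : fdual C A b beta (l + d) - fdual C A b beta l = - dot b d +
    beta^-1 * (ln (\tr (expmx (H (l + d)))) - ln (\tr (expmx (H l)))).
  rewrite /fdual -/(H l) -/(H (l + d)) dotDr.
  by move: (ln _) (ln _) (dot _ _) (dot _ _) => u v x y; ring.
move: (ln _ - _) => D lo hi.
have b0 := beta_gt0.
split.
  by rewrite addrC -lerBlDr opprK ler_pdivlMl.
rewrite addrC -lerBrDr opprK ler_pdivrMl//; apply: le_trans hi _.
rewrite le_eqVlt; apply/orP; left; apply/eqP; by field.
Qed.

Lemma grad_fdual l : grad (fdual C A b beta) l = gibbs_gradient l.
Proof.
by apply: (grad_of_quadratic_bounds normN) => d; exact: fdual_quadratic_bounds.
Qed.

End fdual.

(** * Inexact steepest descent in a general norm *)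

Section descent.
Context {R : realType} {m : nat} (N : 'rV[R]_m -> R) (normN : is_norm N).

(** Smoothness bounds [f l'], optimality replaces the displacement [d] by the trial displacement
    [v], and convexity bounds [dot G v]. The dual norm controls the gradient error along both. *)
Lemma inexact_steepest_descent_step (f : 'rV[R]_m -> R) (G l l' lstar g : 'rV[R]_m)
    (beta gamma eta D a : R) :
    0 < eta -> beta < eta^-1 -> 0 <= a ->
    (forall d, dot G d <= f (l + d) - f l /\
               f (l + d) - f l <= dot G d + beta / 2 * N d ^+ 2) ->
    argmin (fun x => f l + dot g (x - l) + 1 / (2 * eta) * N (x - l) ^+ 2) l' ->
    dual_norm N (g - G) <= gamma ->
    N (l - lstar) ^+ 2 <= D ->
  f l' - f lstar <= (1 - a) * (f l - f lstar)
    + (a ^+ 2 * ((2 * eta^-1 - beta) * D / 2) + gamma ^+ 2 / (eta^-1 - beta)).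
Proof.
move=> eta0 betaeta a0 fb l'min gG ND.
set e := eta^-1 in betaeta *; set c := e - beta.
have c0 : 0 < c by rewrite subr_gt0.
have e0 : 0 < e by rewrite invr_gt0.
have etaE : 1 / (2 * eta) = e / 2 by rewrite div1r invfM mulrC.
pose d := l' - l; pose v := a *: (lstar - l).
have err x : dot g x - dot G x <= gamma * N x.
  rewrite -mulN1r -dotZl scaleN1r -dotDl.
  apply: le_trans (dot_le_dual_norm normN _ _) _.
  by rewrite ler_wpM2r// is_norm_ge0.
(* At [N d] the square is absorbed by the surplus [c / 2] of model curvature over smoothness; at
   [N v] it joins [e / 2], giving [(c + e) / 2] with [c + e = 2 * eta^-1 - beta]. *)
have amgm x : gamma * x <= gamma ^+ 2 / c / 2 + c * x ^+ 2 / 2.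
  rewrite -subr_ge0 (_ : _ - _ = (gamma - c * x) ^+ 2 / (2 * c)).
    by rewrite divr_ge0 ?sqr_ge0// mulr_ge0// ltW.
  by field; rewrite gt_eqF.
have [_] := fb d; rewrite /d [l + _]addrC subrK -/d => fd.
have := err (- d); rewrite (is_normN normN) !dotNr => errd.
have := l'min (l + v); rewrite etaE (addrAC l v) subrr add0r -/d => opt.
have errv := err v.
have Gv : dot G v <= a * (f lstar - f l).
  rewrite dotZr ler_wpM2l//; have [] := fb (lstar - l).
  by rewrite [l + _]addrC subrK.
have Nv : N v ^+ 2 <= a ^+ 2 * D.
  rewrite (is_norm_scale normN) exprMn real_normK ?num_real//.
  by rewrite ler_wpM2l ?sqr_ge0// -(is_normN normN) opprB.
have := amgm (N d); have := amgm (N v).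
have LN : (c + e) * N v ^+ 2 <= (c + e) * (a ^+ 2 * D).
  by rewrite ler_wpM2l// addr_ge0// ltW.
move: (gamma ^+ 2 / c) => q.
rewrite /c in LN *; lra.
Qed.

(** Writing the additive term as [a * E] makes [E] a fixed point of the recursion. *)
Lemma affine_recurrence_le (delta : nat -> R) (a E : R) :
    0 <= a <= 1 -> 0 <= E ->
    (forall t, delta t.+1 <= (1 - a) * delta t + a * E) ->
  forall t, delta t <= (1 - a) ^+ t * delta 0%N + E.
Proof.
move=> /andP[a0 a1] E0 rec; elim=> [|t IH]; first by rewrite expr0 mul1r lerDl.
apply: le_trans (rec t) _.
apply: (@le_trans _ _ ((1 - a) * ((1 - a) ^+ t * delta 0%N + E) + a * E)).
  by rewrite lerD2r ler_wpM2l// subr_ge0.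
rewrite le_eqVlt exprS; apply/orP; left; apply/eqP; ring.
Qed.

End descent.

Theorem theorem19 (R : realType) (n m : nat)
    (C : 'M[R]_n) (A : 'I_m -> 'M[R]_n) (b : 'rV[R]_m)
    (symC : C \is symmetricmx) (symA : forall i, A i \is symmetricmx)
    (feas : sdp_feasible A b !=set0)
    (N : 'rV[R]_m -> R) (normN : is_norm N)
    (specN : forall lam : 'rV[R]_m, spectral_norm (lincomb lam A) <= N lam)
    (beta gamma eta : R) (beta_gt0 : 0 < beta) (gamma_ge0 : 0 <= gamma)
    (eta_gt0 : 0 < eta) (eta_le : eta <= 1 / (2 * beta))
    (lam g : nat -> 'rV[R]_m) (lam0 : lam 0%N = 0)
    (lamS : forall t : nat,
       argmin (fun l : 'rV[R]_m => fdual C A b beta (lam t)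
                 + dot (g t) (l - lam t)
                 + 1 / (2 * eta) * N (l - lam t) ^+ 2)
         (lam t.+1))
    (g_err : forall t : nat,
       dual_norm N (g t - grad (fdual C A b beta) (lam t)) <= gamma)
    (lamstar : 'rV[R]_m) (lamstar_min : argmin (fdual C A b beta) lamstar)
    (D : R)
    (D_sup : ereal_sup (range (fun t : nat => (N (lam t - lamstar) ^+ 2)%:E))
             = D%:E)
    (gamma_le : gamma <= Num.sqrt (3 * beta ^+ 2 * D / 2)) :
  (forall t : nat, (1 <= t)%N ->
     fdual C A b beta (lam t) - fdual C A b beta lamstar
     <= (1 - 2 * gamma / Num.sqrt (2 * (eta^-1 - beta)
                                   * (2 * eta^-1 - beta) * D)) ^+ t
        * (fdual C A b beta (lam 0%N) - fdual C A b beta lamstar)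
        + gamma * Num.sqrt (2 * (2 * eta^-1 - beta) * D)
          / Num.sqrt (eta^-1 - beta))
  /\
  (eta = 1 / (2 * beta) ->
   forall t : nat, (1 <= t)%N ->
     fdual C A b beta (lam t) - fdual C A b beta lamstar
     <= (1 - 2 * gamma / Num.sqrt (6 * beta ^+ 2 * D)) ^+ t
        * (fdual C A b beta (lam 0%N) - fdual C A b beta lamstar)
        + gamma * Num.sqrt (6 * D)).
Proof.
(* An empty matrix has trace 0, so a feasible point of trace 1 excludes [n = 0]. *)
have n_gt0 : (0 < n)%N.
  case: feas => X [_ trX _]; rewrite lt0n; apply/eqP => n0; move: trX.
  rewrite /mxtrace big1 => [/esym/eqP|i _]; first by rewrite oner_eq0.
  by have := ltn_ord i; rewrite [X in (_ < X)%N]n0.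
pose f := fdual C A b beta; pose delta t := f (lam t) - f lamstar.
set e := eta^-1; pose c := e - beta; pose L := 2 * e - beta.
have eE : 2 * beta <= e.
  by rewrite /e -[leLHS]invrK lef_pV2 ?posrE ?invr_gt0 ?mulr_gt0// -div1r.
have c0 : beta <= c by rewrite /c; lra.
have cgt0 : 0 < c by lra.
have L0 : 3 * beta <= L by rewrite /L; lra.
have Lgt0 : 0 < L by lra.
have ND t : N (lam t - lamstar) ^+ 2 <= D.
  by rewrite -lee_fin -D_sup; apply: ereal_sup_ubound; exists t.
have D0 : 0 <= D by apply: le_trans (ND 0%N); exact: sqr_ge0.
pose r := Num.sqrt (2 * L * D); pose s := Num.sqrt c.
have r2 : r ^+ 2 = 2 * L * D by rewrite sqr_sqrtr// !mulr_ge0// ltW.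
have s0 : 0 < s by rewrite sqrtr_gt0.
have s2 : s ^+ 2 = c by rewrite sqr_sqrtr// ltW.
have SE : Num.sqrt (2 * c * L * D) = s * r.
  by rewrite -sqrtrM ?ltW//; congr Num.sqrt; ring.
pose a := 2 * gamma / (s * r); pose E := gamma * r / s.
have r_ge0 : 0 <= r by exact: sqrtr_ge0.
(* This encodes [a <= 1]. The bound on [gamma] gives [4 * gamma ^+ 2 <= 6 * beta ^+ 2 * D], and
   [beta <= c], [3 * beta <= L] bound this by [2 * c * L * D]. *)
have gammar : 2 * gamma <= s * r.
  have g2 : gamma ^+ 2 <= 3 * beta ^+ 2 * D / 2.
    rewrite -[leRHS]sqr_sqrtr ?ler_pXn2r ?nnegrE ?sqrtr_ge0//.
    by rewrite divr_ge0// mulr_ge0// mulr_ge0// sqr_ge0.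
  have cL : beta * (3 * beta) * D <= c * L * D.
    by rewrite ler_wpM2r// ler_pM// ltW// mulr_gt0.
  rewrite -(@ler_pXn2r _ 2) ?nnegrE ?mulr_ge0// ?(ltW s0)//.
  rewrite !exprMn s2 r2; lra.
have a01 : 0 <= a <= 1.
  (* Division by zero yields 0, so [a = 0] in the degenerate case, as in the stated reading. *)
  have [sr0|sr0] := eqVneq (s * r) 0.
    by rewrite /a sr0 invr0 mulr0 lexx ler01.
  have srgt0 : 0 < s * r by rewrite lt_neqAle eq_sym sr0 mulr_ge0// ltW.
  by rewrite /a divr_ge0 ?(ltW srgt0) ?mulr_ge0// ler_pdivrMr// mul1r.
(* For nonzero [r] both terms on the left equal [gamma ^+ 2 / c]; for [r = 0], [gammar] forces
   [gamma = 0]. *)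
have aE : a ^+ 2 * (L * D / 2) + gamma ^+ 2 / c = a * E.
  rewrite /a /E (_ : L * D = r ^+ 2 / 2); last by rewrite r2; field.
  rewrite -s2; have [r0|r0] := eqVneq r 0.
    have -> : gamma = 0.
      by apply/eqP; rewrite eq_le gamma_ge0 andbT; move: gammar; rewrite r0; lra.
    by rewrite !(mulr0, mul0r, expr0n)/= ?(mulr0, mul0r, addr0).
  by field; rewrite r0 gt_eqF.
have main t : delta t <= (1 - a) ^+ t * delta 0%N + E.
  apply: affine_recurrence_le => //; first by rewrite !mulr_ge0// invr_ge0 ltW.
  move=> {}t; rewrite -aE; have /andP[a0 _] := a01.
  apply: (inexact_steepest_descent_step normN eta_gt0 _ a0 _ (lamS t) (g_err t) (ND t)).
    by rewrite -subr_gt0.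
  rewrite (grad_fdual b symC symA normN specN beta_gt0 n_gt0).
  exact: fdual_quadratic_bounds.
split=> [t _|etaE t _].
  have := main t; rewrite /a -SE /E; exact.
(* At this step size [c = beta] and [L = 3 * beta]. *)
have eE2 : e = 2 * beta by rewrite /e etaE div1r invrK.
have := main t; rewrite /a -SE.
have -> : 2 * c * L * D = 6 * beta ^+ 2 * D by rewrite /c /L eE2; ring.
have -> // : E = gamma * Num.sqrt (6 * D).
rewrite /E -mulrA; congr (_ * _); apply: (mulIf (lt0r_neq0 s0)).
rewrite mulfVK ?gt_eqF// -sqrtrM ?mulr_ge0//; congr Num.sqrt.
by rewrite /c /L eE2; ring.
Qed.
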